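(* For every natural number $r \geq 1$ there is a constant $C_r>0$, depending only on $r$, such that the following holds. Let $G$ be an Abelian group of exponent $r$, let $A \subset G$ be a finite non-empty set, and let $K$ be a real number with $|A+A| \leq K|A|$. Then the subgroup $\langle A\rangle$ of $G$ generated by $A$ satisfies $$|\langle A \rangle| \leq \exp\left(C_r K\log^{2}(2K)\right)|A|.$$
   Context: An Abelian group $G$ has exponent $r$ if $r$ is the minimal natural number such that $rx=0_G$ for every $x \in G$. Here $A+A:=\{a+a' : a,a' \in A\}$, and $\log^2(2K)=(\log(2K))^2$. (Since $A\neq\emptyset$, the hypothesis forces $K \geq 1$.) *)

(* Defs.v *)
From mathcomp Require Import all_boot all_order all_algebra finmap.
From mathcomp Require Import boolp classical_sets cardinality.

Set Implicit Arguments.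
Unset Strict Implicit.
Unset Printing Implicit Defensive.

Import GRing.Theory.

Local Open Scope fset_scope.
Local Open Scope classical_set_scope.
Local Open Scope ring_scope.

(* Minimality is among positive integers: 0 kills every group. *)
Definition has_exponent (G : zmodType) (r : nat) : Prop :=
  [/\ (0 < r)%N,
      forall x : G, x *+ r = 0
    & forall m : nat, (0 < m)%N -> (forall x : G, x *+ m = 0) -> (r <= m)%N].

Definition sumset (G : zmodType) (A : {fset G}) : {fset G} :=
  [fset (a + a')%R | a in A, a' in A]%fset.

Definition subgroup_gen (G : zmodType) (A : {fset G}) : set G :=
  smallest [set H : set G | zmod_closed (mem H)] [set` A].

(* Main.v *)
(* Let |A + A| <= K|A|. Choosing greedily O(K) elements of A generating V, every
   translate a + A (a in A) lies in Q = A + V up to a small proportion, so at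
   least half of the b in A move only a small proportion of Q. The set B of such
   almost-periods of Q satisfies |2^n B| <= 4K|B| with V costing O(2^n K)
   generators; hence some 2^i B has doubling O(K^(1/3)) when n = 3. Repeating the
   step on that set with 2^n = O(K^(2/3)) yields a finite subgroup H with
   |H| <= r^O(K) |A| and A contained in O(K^2) cosets of H. Chang's covering
   argument, fed by Petridis' form of Plunnecke's inequality, then produces
   O(K log 2K) elements which together with H generate a group containing A.
   This even gives the exponent O(K log 2K). *)
Require Import Defs.
From mathcomp Require Import all_boot all_order all_algebra finmap.
From mathcomp Require Import boolp classical_sets cardinality.
From mathcomp Require Import reals sequences exp.
From mathcomp Require Import zify ring lra.

Import Order.TTheory GRing.Theory Num.Theory.

Local Open Scope classical_set_scope.
Local Open Scope fset_scope.
Local Open Scope ring_scope.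

(** * Cardinalities of products and sumsets *)

Lemma cardfsM (T U : choiceType) (A : {fset T}) (B : {fset U}) :
  #|` A `*` B| = (#|` A| * #|` B|)%N.
Proof.
rewrite -(size_allpairs pair); apply/perm_size/uniq_perm; first exact: fset_uniq.
  by apply: allpairs_uniq => [||[x y] [x' y'] _ _ [-> ->]] //; exact: fset_uniq.
move=> [x y]; rewrite inE /=; apply/andP/allpairsP => [[xA yB]|].
  by exists (x, y).
by move=> [[x' y'] /= [xA yB [-> ->]]].
Qed.

Section Sumsets.
Context {G : zmodType}.
Implicit Types A B C D S V W X : {fset G}.

Definition addf A B : {fset G} := [fset (a + b)%R | a in A, b in B]%fset.

Local Notation "A :+: B" := (addf A B) (at level 50, left associativity).

Definition is_subgroup V := zmod_closed (mem V).

Lemma addfP A B x :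
  reflect (exists2 a, a \in A & exists2 b, b \in B & x = a + b)
          (x \in A :+: B).
Proof. by apply: (iffP (imfset2P _ _ _ _ _)). Qed.

Lemma mem_addf A B a b : a \in A -> b \in B -> a + b \in A :+: B.
Proof. by move=> aA bB; apply/addfP; exists a => //; exists b. Qed.

Lemma addfC A B : A :+: B = B :+: A.
Proof.
by apply/fsetP => x; apply/addfP/addfP => -[a aA [b bB ->]];
  exists b => //; exists a => //; rewrite addrC.
Qed.

Lemma addfA A B C : A :+: (B :+: C) = A :+: B :+: C.
Proof.
apply/fsetP => x; apply/addfP/addfP.
- move=> [a aA [_ /addfP [b bB [c cC ->]] ->]].
  by exists (a + b); [exact: mem_addf|exists c; rewrite ?addrA].
- move=> [_ /addfP [a aA [b bB ->]] [c cC ->]].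
  by exists a => //; exists (b + c); [exact: mem_addf|rewrite addrA].
Qed.

Lemma addfS A A' B B' : A `<=` A' -> B `<=` B' -> A :+: B `<=` A' :+: B'.
Proof.
move=> /fsubsetP AA' /fsubsetP BB'; apply/fsubsetP => _ /addfP [a aA [b bB ->]].
by apply: mem_addf; [exact: AA'|exact: BB'].
Qed.

Lemma fsub_addl A B : 0 \in B -> A `<=` A :+: B.
Proof. by move=> B0; apply/fsubsetP => x xA; rewrite -[x]addr0 mem_addf. Qed.

Lemma addf_fset0 A : A :+: fset0 = fset0.
Proof. by apply/fsetP => x; rewrite inE; apply/addfP => -[a _ [b]]; rewrite inE. Qed.

Lemma addfU A B C : A :+: (B `|` C) = (A :+: B) `|` (A :+: C).
Proof.
apply/fsetP => x; rewrite inE; apply/addfP/orP.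
- move=> [a aA [b /fsetUP [bB|bC] ->]]; [left|right]; exact: mem_addf.
- by case=> /addfP [a aA [b bB ->]]; exists a => //; exists b; rewrite // inE bB ?orbT.
Qed.

Lemma card_addf1 A x : #|` A :+: [fset x]| = #|` A|.
Proof.
have -> : A :+: [fset x] = [fset a + x | a in A].
  apply/fsetP => y; apply/addfP/imfsetP => [[a aA [_ /fset1P -> ->]]|[a aA ->]].
    by exists a.
  by exists a => //; exists x; rewrite ?fset11.
by rewrite card_imfset //; exact: addIr.
Qed.

Lemma leq_card_addf A B : (#|` A :+: B| <= #|` A| * #|` B|)%N.
Proof.
rewrite -cardfsM; set f := fun p : G * G => p.1 + p.2.
apply: (@leq_trans #|` f @` (A `*` B)|); last exact: leq_imfset_card.
apply/fsubset_leq_card/fsubsetP => _ /addfP [a aA [b bB ->]].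
by apply/imfsetP; exists (a, b); rewrite //= inE /= aA bB.
Qed.

Lemma leq_card_addl A B : B != fset0 -> (#|` A| <= #|` A :+: B|)%N.
Proof.
case/fset0Pn => b bB; rewrite -(card_addf1 A b).
by apply/fsubset_leq_card/addfS; rewrite ?fsubset_refl ?fsub1set.
Qed.

(** * Finite subgroups and the Ruzsa triangle inequality *)

Lemma subgroup0 {V} : is_subgroup V -> 0 \in V. Proof. by case. Qed.

Lemma subgroupB V x y : is_subgroup V -> x \in V -> y \in V -> x - y \in V.
Proof. by case=> _; apply. Qed.

Lemma subgroupN V x : is_subgroup V -> x \in V -> - x \in V.
Proof. by move=> gV xV; rewrite -sub0r; apply: subgroupB => //; exact: subgroup0. Qed.

Lemma subgroupD V x y : is_subgroup V -> x \in V -> y \in V -> x + y \in V.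
Proof. by move=> gV xV yV; rewrite -[y]opprK; apply/subgroupB/subgroupN. Qed.

Lemma addf_subgroup V W : is_subgroup V -> is_subgroup W -> is_subgroup (V :+: W).
Proof.
move=> gV gW; split=> [|x y].
  by rewrite -[0 in X in X \in _]addr0; apply: mem_addf; exact: subgroup0.
move=> /addfP [v vV [w wW ->]] /addfP [v' v'V [w' w'W ->]].
by rewrite opprD addrACA; apply: mem_addf; exact: subgroupB.
Qed.

(* (x, y + z) |-> (x + y, x - z) is injective: the difference recovers y + z. *)
Lemma ruzsa_triangle X A V : is_subgroup V ->
  (#|` X| * #|` A :+: V| <= #|` X :+: A| * #|` X :+: V|)%N.
Proof.
move=> gV; rewrite -!cardfsM.
have /choice [f fP] w : exists p : G * G,
    w \in A :+: V -> [/\ p.1 \in A, p.2 \in V & w = p.1 + p.2].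
  case: (boolP (w \in A :+: V)) => [/addfP [a aA [v vV ->]]|_]; first by exists (a, v).
  by exists (0, 0).
pose g (p : G * G) := (p.1 + (f p.2).1, p.1 - (f p.2).2).
have <- : #|` g @` (X `*` (A :+: V))| = #|` X `*` (A :+: V)|.
  rewrite card_in_imfset //.
  move=> [x w] [x' w']; rewrite !inE /= => /andP [_ wI] /andP [_ w'I] [e1 e2].
  have [_ _ ew] := fP w wI; have [_ _ ew'] := fP w' w'I.
  have aux (y a b : G) : a + b = y + a - (y - b).
    by rewrite opprB [RHS]addrC addrA subrK addrC.
  have eww : w = w' by rewrite ew ew' (aux x) e1 e2 -aux.
  by move: e1; rewrite -eww => /addIr ->.
apply/fsubset_leq_card/fsubsetP => _ /imfsetP [[x w] /= + ->].
rewrite !inE /= => /andP [xX wI]; have [h1 h2 _] := fP w wI.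
by rewrite /= !mem_addf //; apply: subgroupN.
Qed.

(** Generators are added one at a time: the multiples of one element form a subgroup with at most
    [r] elements. *)
Lemma subgroup_closure (r : nat) S : (0 < r)%N -> (forall x : G, x *+ r = 0) ->
  exists V, [/\ is_subgroup V, S `<=` V & (#|` V| <= r ^ #|` S|)%N].
Proof.
move=> r0 Gr; elim/fset1U_rect: S => [|x S xS [V [gV SV cV]]].
  by exists [fset 0]; split; [split=> [|u v]; rewrite ?inE // => /eqP -> /eqP ->;
    rewrite subr0| rewrite fsub0set | rewrite cardfs1 cardfs0].
pose Z := [fset x *+ i | i in iota 0 r].
have ZE y : reflect (exists i, y = x *+ i) (y \in Z).
  apply: (iffP (imfsetP _ _ _ _)) => /= [[i _ ->]|[i ->]]; first by exists i.
  exists (i %% r)%N; first by rewrite mem_iota ltn_mod.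
  by rewrite {1}(divn_eq i r) mulrnDr mulnC mulrnA Gr mul0rn add0r.
have gZ : is_subgroup Z.
  split=> [|u v]; first by apply/ZE; exists 0; rewrite mulr0n.
  (* As [r] kills the group, the natural multiple [(r.-1) * j] stands for minus [j]. *)
  move=> /ZE [i ->] /ZE [j ->]; apply/ZE; exists (i + (r.-1) * j)%N.
  rewrite mulrnDr; congr (_ + _); apply/eqP; rewrite eq_sym -addr_eq0.
  by rewrite -mulrnDr -mulSnr prednK // mulrnA Gr mul0rn.
exists (Z :+: V); split; first exact: addf_subgroup.
  rewrite fsubUset fsub1set (fsubset_trans SV) ?andbT.
    by rewrite -[x]addr0 mem_addf //; [apply/ZE; exists 1%N|exact: subgroup0].
  by rewrite addfC fsub_addl //; exact: subgroup0.
rewrite cardfsU1 xS add1n expnS; apply: leq_trans (leq_card_addf _ _) _.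
rewrite leq_mul //; apply: leq_trans (leq_imfset_card _ _ _) _.
by apply: leq_trans (size_undup _) _; rewrite size_iota.
Qed.

(** * Extremal subsets: Petridis' inequality and greedy covers *)

Lemma exists_max_subset A (P : {fset G} -> Prop) (h : {fset G} -> nat) :
  (exists2 S, S `<=` A & P S) ->
  exists S, [/\ S `<=` A, P S &
    forall S', S' `<=` A -> P S' -> (h S' <= h S)%N].
Proof.
move=> [S0 S0A PS0].
pose Q n := `[< exists S, [/\ S `<=` A, P S & h S = n] >].
have exQ : exists n, Q n by exists (h S0); apply/asboolP; exists S0.
have ubQ n : Q n -> (n <= \max_(S <- fpowerset A) h S)%N.
  by move=> /asboolP [S [SA _ <-]]; apply: leq_bigmax_seq; rewrite // fpowersetE.
case: (ex_maxnP exQ ubQ) => _ /asboolP [S [SA PS <-]] maxS.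
exists S; split=> // S' S'A PS'; apply: maxS; apply/asboolP; by exists S'.
Qed.

(* Petridis: instead of minimising |X + A| / |X|, maximise k |X| - |X + A|;
   the additive constant |A + A| keeps this inside nat. *)
Lemma petridis A (k : nat) : A != fset0 -> (#|` A :+: A| <= k * #|` A|)%N ->
  exists X, [/\ X `<=` A, X != fset0 &
    forall C, (#|` X :+: A :+: C| <= k * #|` X :+: C|)%N].
Proof.
move=> A0 hA.
have le2 X : X `<=` A -> (#|` X :+: A| <= #|` A :+: A|)%N.
  by move=> XA; apply/fsubset_leq_card/addfS.
have [X [XA X0 maxX]] := @exists_max_subset A (fun X => X != fset0)
  (fun X => k * #|` X| + (#|` A :+: A| - #|` X :+: A|))%N
  (ex_intro2 _ _ A (fsubset_refl A) A0).
(* Maximality, freed from truncated subtraction. Empty [Y] is no competitor, so there the claim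
   comes from comparing [X] with [A] itself. *)
have key Y : Y `<=` X -> (k * #|` Y| + #|` X :+: A| <= k * #|` X| + #|` Y :+: A|)%N.
  move=> YX; have YA := fsubset_trans YX XA; have := le2 _ XA; have := le2 _ YA.
  case: (eqVneq Y fset0) => [->|Y0].
    by have := maxX A (fsubset_refl A) A0; rewrite (addfC fset0) addf_fset0 cardfs0; lia.
  by have := maxX Y YA Y0; lia.
exists X; split=> // C; elim/fset1U_rect: C => [|c C cC IH].
  by rewrite !addf_fset0 cardfs0.
(* For [x] in [X1] all of [x + A + c] already lies in [X + A + C]. Adding [c] thus saves at least
   [|X1 + A|] elements on the left and at most [|X1|] on the right; [key] at [X1] compares the
   two. *)
rewrite !addfU; pose X1 := [fset x in X | x + c \in X :+: C].
have X1X : X1 `<=` X by apply/fsubsetP => x; rewrite !inE => /andP [].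
have h1 : (#|` X1 :+: A| <=
    #|` (X :+: A :+: [fset c]) `&` (X :+: A :+: C)|)%N.
  rewrite -(card_addf1 _ c); apply/fsubset_leq_card/fsubsetP => _
    /addfP [_ /addfP [x xX1 [a aA ->]] [_ /fset1P -> ->]].
  move: xX1; rewrite !inE => /andP [xX xcXC]; apply/andP; split.
    by rewrite !mem_addf // fset11.
  by rewrite -addfA [A :+: C]addfC addfA addrAC mem_addf.
have h2 : (#|` (X :+: [fset c]) `&` (X :+: C)| <= #|` X1|)%N.
  rewrite -(card_addf1 X1 c); apply/fsubset_leq_card/fsubsetP => y.
  rewrite inE => /andP [/addfP [x xX [_ /fset1P -> ->]] xcXC].
  by rewrite mem_addf ?fset11 // !inE xX.
have := cardfsUI (X :+: A :+: [fset c]) (X :+: A :+: C).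
have := cardfsUI (X :+: [fset c]) (X :+: C).
rewrite !card_addf1; have := key _ X1X.
move: h1 h2 IH; nia.
Qed.

(** Take [S] of maximal size such that its translates of [A] contribute on average at least
    [|A| / N] elements each. A translate bringing more than [|A| / N] new elements could still be
    added. *)
Lemma greedy_cover A (N : nat) : exists S,
  [/\ S `<=` A, (#|` S| * #|` A| <= N * #|` A :+: S|)%N &
    forall a, a \in A ->
      (N * #|` (A :+: [fset a]) `\` (A :+: S)| <= #|` A|)%N].
Proof.
have [|S [SA PS maxS]] := @exists_max_subset A
  (fun S => (#|` S| * #|` A| <= N * #|` A :+: S|)%N) (fun S => #|` S|).
  by exists fset0; rewrite ?fsub0set // cardfs0.
exists S; split=> // a aA; rewrite leqNgt; apply/negP => h.
have aS : a \notin S.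
  apply: contraTN h => aS; rewrite -leqNgt.
  have /eqP -> : (A :+: [fset a]) `\` (A :+: S) == fset0.
    by rewrite fsetD_eq0; apply: addfS; rewrite ?fsubset_refl ?fsub1set.
  by rewrite cardfs0 muln0.
have := maxS (a |` S); rewrite fsubUset fsub1set aA SA cardfsU1 aS add1n ltnn.
move=> /(_ isT) maxSa; apply/notF/maxSa; rewrite addfU fsetUC cardfsU.
have := cardfsD (A :+: [fset a]) (A :+: S); have := fsubsetIl (A :+: [fset a]) (A :+: S).
move=> /fsubset_leq_card; rewrite [(A :+: S) `&` _]fsetIC; nia.
Qed.

(** * Double counting and almost-periods *)

Lemma card_fset_sum (T : choiceType) (E : {fset T}) (P : pred T) :
  #|` [fset x in E | P x]| = (\sum_(x <- E) P x)%N.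
Proof. by rewrite card_imfset //= size_filter -sum1_count big_mkcond. Qed.

Lemma double_count A B (P : G -> G -> bool) :
  (\sum_(a <- A) #|` [fset b in B | P a b]| =
   \sum_(b <- B) #|` [fset a in A | P a b]|)%N.
Proof.
under eq_bigr do rewrite card_fset_sum; rewrite exchange_big /=.
by apply: eq_bigr => b _; rewrite card_fset_sum.
Qed.

Lemma leq_sum_card A (f : G -> nat) (c : nat) :
  (forall a, a \in A -> f a <= c)%N -> (\sum_(a <- A) f a <= #|` A| * c)%N.
Proof.
move=> fc; rewrite big_seq; apply: leq_trans (leq_sum _ fc) _.
by rewrite -big_seq big_const_seq count_predT iter_addn_0 mulnC.
Qed.

Lemma geq_sum_card A (f : G -> nat) (c : nat) :
  (forall a, a \in A -> c <= f a)%N -> (#|` A| * c <= \sum_(a <- A) f a)%N.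
Proof.
move=> fc; rewrite [leqRHS]big_seq; apply: leq_trans (leq_sum _ fc).
by rewrite -big_seq big_const_seq count_predT iter_addn_0 mulnC.
Qed.

(** This is the size of [A] intersected with [A - t], that is, the number of representations of [t]
    as a difference in [A]. *)
Definition overlap A (t : G) : nat := #|` [fset q in A | q + t \in A]|.

Definition defect A (t : G) : nat := #|` [fset q in A | q + t \notin A]|.

Lemma defectE A t : (defect A t + overlap A t)%N = #|` A|.
Proof.
rewrite addnC /defect /overlap !card_fset_sum -big_split -sum1_size /=.
by apply: eq_bigr => q _; case: (_ \in _).
Qed.

(** If [q] in [A] leaves [A] under [s + t], then either [q + s] is outside [A], or [q + s] is a
    point of [A] that [t] moves out. *)
Lemma defectD A s t : (defect A (s + t)%R <= defect A s + defect A t)%N.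
Proof.
pose U := [fset q in A | q + s \notin A].
pose W := [fset q in A | q + t \notin A].
have -> : defect A t = #|` W :+: [fset - s]| by rewrite card_addf1.
rewrite -[defect A s]/#|` U|.
apply: leq_trans (_ : _ <= #|` U `|` (W :+: [fset - s])|)%N _; last first.
  by rewrite cardfsU leq_subr.
apply/fsubset_leq_card/fsubsetP => q; rewrite !inE => /andP [qA qstA].
rewrite qA /=; case: (boolP (q + s \in A)) => //= qsA.
by rewrite -[q](addrK s) mem_addf ?fset11 // !inE qsA -addrA.
Qed.

Lemma defectN A t : defect A (- t) = defect A t.
Proof.
suff le u : (overlap A u <= overlap A (- u))%N.
  have := defectE A t; have := defectE A (- t); have := le t; have := le (- t).
  rewrite opprK; lia.
rewrite /overlap -(card_addf1 _ u); apply/fsubset_leq_card/fsubsetP => _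
  /addfP [q qI [_ /fset1P -> ->]]; move: qI; rewrite !inE => /andP [qA quA].
by rewrite quA addrK.
Qed.

Definition popular A (M : nat) : {fset G} :=
  [fset t in [fset (a - b)%R | a in A, b in A]%fset | (M * defect A t <= #|` A|)%N].

(** With [M >= 2] a small defect leaves a positive overlap, so [t] is a difference of two elements
    of [A]. *)
Lemma popularP A (M : nat) t : A != fset0 -> (2 <= M)%N ->
  reflect (M * defect A t <= #|` A|)%N (t \in popular A M).
Proof.
move=> A0 M2; apply: (iffP idP) => [|h]; rewrite !inE /=; first by case/andP.
rewrite [X in _ && X]h andbT.
have : (0 < overlap A t)%N.
  have := defectE A t; rewrite -cardfs_gt0 in A0; nia.
rewrite cardfs_gt0 => /fset0Pn [q]; rewrite !inE => /andP [qA qtA].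
by apply/imfset2P; exists (q + t) => //; exists q; rewrite //= addrC addKr.
Qed.

(** Each such [t] has at least [|A| / 2] representations as a difference, among [|A|^2] pairs in
    all. *)
Lemma card_popular A : A != fset0 -> (#|` popular A 2| <= 2 * #|` A|)%N.
Proof.
move=> A0; set T := popular A 2.
have E : (\sum_(t <- T) overlap A t =
          \sum_(q <- A) #|` [fset t in T | (q + t)%R \in A]|)%N.
  exact: double_count.
have h2 : (\sum_(t <- T) overlap A t <= #|` A| * #|` A|)%N.
  rewrite E; apply: leq_sum_card => q qA; rewrite -(card_addf1 _ q).
  apply/fsubset_leq_card/fsubsetP => _ /addfP [t tI [_ /fset1P -> ->]].
  by move: tI; rewrite !inE addrC => /andP [].
have ov t : t \in T -> (#|` A| <= 2 * overlap A t)%N.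
  by move=> /(popularP _ _ _ A0 (leqnn 2)); have := defectE A t; lia.
have h1 : (#|` T| * #|` A| <= 2 * \sum_(t <- T) overlap A t)%N.
  by rewrite big_distrr; apply: geq_sum_card.
by rewrite -cardfs_gt0 in A0; nia.
Qed.

(** * Iterated doubling: [iter n dbl A] is the [2^n]-fold sumset *)

Definition dbl A : {fset G} := A :+: A.

Definition symmetric0 A := 0 \in A /\ forall x, x \in A -> - x \in A.

Lemma symmetric0_dbl A n : symmetric0 A -> symmetric0 (iter n dbl A).
Proof.
move=> sA; elim: n => //= n [Z0 ZN]; split=> [|_ /addfP [a aA [b bA ->]]].
  by rewrite -[0 in X in X \in _]addr0 mem_addf.
by rewrite opprD mem_addf //; apply: ZN.
Qed.

Lemma fsub_iter_dbl A n : 0 \in A -> A `<=` iter n dbl A.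
Proof.
move=> A0; have h m : 0 \in iter m dbl A.
  by elim: m => //= m IH; rewrite -[0 in X in X \in _]addr0 mem_addf.
elim: n => [|n IH] //=.
by apply: fsubset_trans IH _; apply: fsub_addl.
Qed.

Lemma iter_dbl_mono A m n : 0 \in A -> (m <= n)%N ->
  iter m dbl A `<=` iter n dbl A.
Proof.
move=> A0 mn; rewrite -(subnK mn) iterD; apply: fsub_iter_dbl.
by have /fsubsetP := fsub_iter_dbl A m A0; apply.
Qed.

(** By subadditivity each doubling of [B] at most doubles the defect. *)
Lemma defect_iter_dbl A B (c : nat) n :
  (forall t, t \in B -> (c * 2 ^ n * defect A t <= #|` A|)%N) ->
  forall t, t \in iter n dbl B -> (c * defect A t <= #|` A|)%N.
Proof.
elim: n c => [|n IH] c hB t; first by rewrite -[c]muln1 => /hB.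
rewrite iterS => /addfP [u uB [v vB ->]].
have h w : w \in iter n dbl B -> (c * 2 * defect A w <= #|` A|)%N.
  by apply: IH => x xB; rewrite -(mulnA c) -expnS; apply: hB.
apply: leq_trans (leq_mul (leqnn c) (defectD A u v)) _.
by have := h u uB; have := h v vB; rewrite mulnDr; lia.
Qed.

(* Every element of B almost fixes Q := A + V, where V is generated by a greedy
   cover of A + A by few translates of A; almost-invariance degrades only
   linearly under addition, which is why the 2^n-fold sumset of B stays small. *)
Lemma popular_sumset (r : nat) A (k n : nat) :
  (0 < r)%N -> (forall x : G, x *+ r = 0) ->
  A != fset0 -> (#|` A :+: A| <= k * #|` A|)%N ->
  exists B, [/\ symmetric0 B,
    (#|` iter n dbl B| <= 2 * (r ^ (4 * 2 ^ n * k) * #|` A|))%N,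
    (#|` iter n dbl B| <= 4 * k * #|` B|)%N &
    (#|` A| <= 2 * #|` A `&` B|)%N].
Proof.
(* The factor [2 ^ n] pays for [n] doublings; the remaining 2 is what [card_popular] requires. *)
move=> r0 Gr A0 hA; set M := (2 * 2 ^ n)%N.
have M2 : (2 <= M)%N by rewrite /M leq_pmulr // expn_gt0.
(* The cover is finer than [M] by a factor 2, to be spent on Markov's inequality. *)
have [S [SA cS covS]] := greedy_cover A (2 * M).
have A_gt0 : (0 < #|` A|)%N by rewrite cardfs_gt0.
have {}cS : (#|` S| <= 4 * 2 ^ n * k)%N.
  have h : (#|` A :+: S| <= k * #|` A|)%N.
    by apply: leq_trans hA; apply/fsubset_leq_card/addfS; rewrite ?fsubset_refl.
  rewrite -(leq_pmul2r A_gt0); apply: leq_trans cS _.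
  by apply: leq_trans (leq_mul (leqnn _) h) _; rewrite /M !mulnA leqnn.
have [V [gV SV cV]] := subgroup_closure r S r0 Gr.
pose Q := A :+: V.
have Q0 : Q != fset0.
  rewrite -cardfs_gt0; apply: leq_trans A_gt0 _; apply: leq_card_addl.
  by apply/fset0Pn; exists 0; exact: subgroup0.
have QV q v : q \in Q -> v \in V -> q + v \in Q.
  move=> /addfP [a aA [w wV ->]] vV; rewrite -addrA mem_addf //.
  exact: subgroupD.
have cQ : (#|` Q| <= r ^ (4 * 2 ^ n * k) * #|` A|)%N.
  apply: leq_trans (leq_card_addf _ _) _; rewrite mulnC leq_mul2r.
  apply/orP; right; apply: leq_trans cV _; exact: leq_pexp2l.
have out q : q \in Q -> (2 * M * #|` [fset b in A | (q + b)%R \notin Q]| <= #|` A|)%N.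
  move=> /addfP [a aA [v vV ->]]; apply: leq_trans (covS a aA).
  rewrite leq_mul2l; apply/orP; right; rewrite -(card_addf1 _ a).
  apply/fsubset_leq_card/fsubsetP => _ /addfP [b bI [_ /fset1P -> ->]].
  move: bI; rewrite !inE => /andP [bA qbQ]; rewrite andbC mem_addf ?fset11 //=.
  apply: contra qbQ => baS; rewrite addrAC [a + b]addrC; apply: QV => //.
  by move: baS; apply/fsubsetP/addfS; rewrite ?fsubset_refl.
(* Summing [out] over [q] bounds the average defect of [b] in [A] by [|Q| / (2M)]; by Markov at
   least half of [A] is popular. *)
have sum_defect : (2 * M * \sum_(b <- A) defect Q b <= #|` Q| * #|` A|)%N.
  have -> : (\sum_(b <- A) defect Q b =
             \sum_(q <- Q) #|` [fset b in A | (q + b)%R \notin Q]|)%N.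
    exact: double_count.
  by rewrite big_distrr; apply: leq_sum_card.
pose A' := A `&` popular Q M.
have cA' : (#|` A| <= 2 * #|` A'|)%N.
  have h : (#|` A `\` popular Q M| * #|` Q| <= M * \sum_(b <- A) defect Q b)%N.
    have -> : A `\` popular Q M = [fset b in A | b \notin popular Q M].
      by apply/fsetP => b; rewrite !inE andbC.
    rewrite card_fset_sum big_distrl big_distrr [leqLHS]big_seq [leqRHS]big_seq.
    apply: leq_sum => b bA; case: (boolP (b \in popular Q M)) => //= bP.
    by rewrite mul1n ltnW // ltnNge; apply: contra bP => /popularP; apply.
  have := cardfsID (popular Q M) A; rewrite -/A'.
  have Q_gt0 : (0 < #|` Q|)%N by rewrite cardfs_gt0.
  rewrite -(leq_pmul2r Q_gt0); nia.
(* [Q] is invariant under [V], so its defect is constant on cosets of [V]. *)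
have A'V : A' :+: V `<=` popular Q M.
  apply/fsubsetP => _ /addfP [b + [v vV ->]]; rewrite inE => /andP [_ bP].
  apply/popularP => //; have -> : defect Q (b + v) = defect Q b; last exact/popularP.
  suff dv w : w \in V -> defect Q w = 0%N.
    apply/eqP; rewrite eqn_leq; have := defectD Q b v; rewrite (dv v vV) addn0 => -> /=.
    by have := defectD Q (b + v) (- v); rewrite addrK (dv (- v)) ?addn0 //; apply: subgroupN.
  move=> wV; apply/eqP; rewrite cardfs_eq0; apply/eqP/fsetP => q; rewrite !inE.
  by apply/negP => /andP [qQ /negP]; apply; apply: QV.
have QB : (#|` Q| <= 2 * k * #|` popular Q M|)%N.
  have A'_gt0 : (0 < #|` A'|)%N by lia.
  rewrite -(leq_pmul2l A'_gt0); apply: leq_trans (ruzsa_triangle A' A V gV) _.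
  have h1 : (#|` A' :+: A| <= k * #|` A|)%N.
    apply: leq_trans hA; apply/fsubset_leq_card/addfS; first exact: fsubsetIl.
    exact: fsubset_refl.
  apply: leq_trans (leq_mul h1 (fsubset_leq_card A'V)) _.
  rewrite !mulnA leq_mul2r; apply/orP; right.
  by apply: leq_trans (leq_mul (leqnn k) cA') _; rewrite mulnC [(2 * _)%N]mulnC.
have cB : (#|` iter n dbl (popular Q M)| <= 2 * #|` Q|)%N.
  apply: leq_trans (card_popular Q Q0); apply/fsubset_leq_card/fsubsetP => t.
  move=> h; apply/popularP => //; move: t h; apply: defect_iter_dbl => t.
  by move/popularP; apply.
exists (popular Q M); split=> //.
- split=> [|x /popularP hx]; apply/popularP => //.
    suff -> : defect Q 0 = 0%N by rewrite muln0.
    apply/eqP; rewrite cardfs_eq0; apply/eqP/fsetP => q; rewrite !inE.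
    by rewrite addr0 andbN.
  by rewrite defectN; apply: hx.
- by apply: leq_trans cB _; rewrite leq_mul2l cQ orbT.
- by apply: leq_trans cB _; rewrite -[(4 * k)%N]/((2 * 2) * k)%N -!mulnA leq_mul2l mulnA QB orbT.
Qed.

(** * From slow growth to a subgroup, and Chang's covering *)

Lemma growth_pigeonhole (f : nat -> nat) (c n : nat) :
  (f n < c ^ n * f 0)%N -> exists2 i, (i < n)%N & (f i.+1 < c * f i)%N.
Proof.
elim: n => [|n IH]; first by rewrite mul1n ltnn.
case: (ltnP (f n.+1) (c * f n)) => [|le h]; first by exists n.
have [|i lin fi] := IH; last by exists i => //; apply: ltnW.
case: c le h {IH} => [|c] le h; first by rewrite expnS !mul0n in h.
by rewrite -(ltn_pmul2l (ltn0Sn c)) mulnA -expnS; apply: leq_ltn_trans h.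
Qed.

(** For [t] in [X + X] and [x] in [X], both [X] and [X + (t + x)] lie in the fourfold sumset, which
    is too small for them to be disjoint. So [t + x] lies in [X - X = X + X], and [X + X] absorbs
    [X]. *)
Lemma subgroup_of_small_fourfold X : symmetric0 X ->
  (#|` dbl (dbl X)| < 2 * #|` X|)%N -> is_subgroup (dbl X).
Proof.
move=> [X0 XN] cX.
have abs t x : t \in dbl X -> x \in X -> t + x \in dbl X.
  move=> tX xX; have : (X :+: [fset (t + x)]) `&` X != fset0.
    apply: contraTneq cX => dis; rewrite -leqNgt.
    have := cardfsUI (X :+: [fset (t + x)]) X.
    rewrite dis cardfs0 addn0 card_addf1 addnn -mul2n => <-.
    apply/fsubset_leq_card; rewrite fsubUset; apply/andP; split.
      apply/fsubsetP => _ /addfP [y yX [_ /fset1P -> ->]].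
      by rewrite addrCA mem_addf // mem_addf.
    exact: (fsub_iter_dbl X 2).
  case/fset0Pn => y; rewrite inE => /andP [/addfP [z zX [_ /fset1P -> yE]] yX].
  have -> : t + x = - z + y by rewrite yE addKr.
  by rewrite mem_addf // XN.
split=> [|u v uX /addfP [a aX [b bX ->]]].
  by rewrite -[0 in X in X \in _]addr0 mem_addf.
by rewrite opprD addrA; apply: (abs _ _ _ (XN _ bX)); apply: (abs _ _ _ (XN _ aX)).
Qed.

(* As long as A is not covered, D can be replaced by a disjoint union of 2k
   translates of D, doubling |D| relative to |X + D|. *)
Lemma chang_covering A X (k : nat) : (0 < k)%N ->
  (forall C, (#|` X :+: A :+: C| <= k * #|` X :+: C|)%N) ->
  X != fset0 -> forall (n : nat) D, D != fset0 ->
  (#|` X :+: D| < 2 ^ n * #|` D|)%N ->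
  exists2 T, (#|` T| <= 2 * k * n)%N &
    forall W, is_subgroup W -> D `<=` W -> T `<=` W -> A `<=` W.
Proof.
move=> k0 hX X0; elim=> [|n IH] D D0 hD.
  have := leq_card_addl D X X0; rewrite addfC leqNgt.
  by rewrite mul1n in hD; rewrite hD.
(* The product formula for [|D + S|] says that the translates of [D] by [S] are disjoint. *)
have [|S [SA [S2k cS] maxS]] := exists_max_subset A
  (fun S => (#|` S| <= 2 * k)%N /\ #|` D :+: S| = (#|` D| * #|` S|)%N)
  (fun S => #|` S|).
  by exists fset0; rewrite ?fsub0set // cardfs0 addf_fset0 cardfs0 muln0.
case: (ltnP #|` S| (2 * k)) => [S_lt|S_ge].
  (* When [S] stops short of [2k], every further [D + a] meets [D + S], so [a] lies in [D + S - D],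
     inside [W]. *)
  exists S => [|W gW DW SW].
    by apply: leq_trans S2k _; rewrite leq_pmulr.
  apply/fsubsetP => a aA; case: (boolP (a \in S)) => aS.
    by move: aS; apply/fsubsetP.
  have : (D :+: [fset a]) `&` (D :+: S) != fset0.
    apply: contraTneq S_lt => dis; rewrite -leqNgt.
    have := cardfsUI (D :+: [fset a]) (D :+: S).
    rewrite dis cardfs0 addn0 card_addf1 cS -addfU => cSa.
    rewrite leqNgt; apply/negP => S_lt.
    have := maxS (a |` S); rewrite fsubUset fsub1set aA SA cardfsU1 aS add1n ltnn.
    by move=> /(_ isT) maxSa; apply/notF/maxSa; split; rewrite // cSa mulnS.
  case/fset0Pn => y; rewrite inE => /andP [/addfP [d dD [_ /fset1P -> yE]]].
  move=> /addfP [d' d'D [s sS yE']].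
  have -> : a = d' + s - d by rewrite -yE' yE addrC addKr.
  have memW E z : E `<=` W -> z \in E -> z \in W by move=> /fsubsetP; apply.
  apply: subgroupB => //; last exact: memW dD.
  by apply: subgroupD => //; [exact: memW d'D|exact: memW sS].
have {S_ge S2k} Sk : #|` S| = (2 * k)%N by apply/eqP; rewrite eqn_leq S2k.
rewrite Sk in cS; rewrite -cardfs_gt0 in D0.
(* The numerator grows by at most [k], by [hX], and [|D|] grows by exactly [2k]: the ratio is
   halved. *)
have hD' : (#|` X :+: (D :+: S)| < 2 ^ n * #|` D :+: S|)%N.
  apply: leq_ltn_trans (_ : _ <= k * #|` X :+: D|)%N _.
    apply: leq_trans (hX D); apply: fsubset_leq_card.
    rewrite -(addfA X A D) (addfC D S).
    by do 2![apply: addfS; rewrite ?fsubset_refl //].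
  rewrite cS; apply: leq_trans (_ : k * (2 ^ n.+1 * #|` D|) <= _)%N.
    by rewrite ltn_pmul2l.
  by rewrite expnS; nia.
have [|T cT hT] := IH (D :+: S) _ hD'.
  by rewrite -cardfs_gt0 cS !muln_gt0 D0 k0.
exists (S `|` T) => [|W gW DW].
  rewrite cardfsU; apply: leq_trans (leq_subr _ _) _.
  by rewrite Sk mulnS leq_add2l.
rewrite fsubUset => /andP [SW TW]; apply: hT => //.
apply/fsubsetP => _ /addfP [d dD [s sS ->]].
by apply: subgroupD => //; [move: dD|move: sS]; apply/fsubsetP.
Qed.

(** * Combining the steps: an integer bound *)

Lemma exists_cube_root (k : nat) : (0 < k)%N ->
  exists c, [/\ (0 < c)%N, (k < c ^ 3)%N & (c ^ 3 <= 8 * k)%N].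
Proof.
move=> k0; have ex : exists c, (k < c ^ 3)%N by exists k.+1; rewrite !expnS; nia.
case: (ex_minnP ex) => [[|[|c]]] hc minc; first by rewrite exp0n in hc.
  by rewrite exp1n in hc; lia.
have le : (c.+1 ^ 3 <= k)%N by rewrite leqNgt; apply/negP => /minc; rewrite ltnn.
by exists c.+2; split=> //; move: le; rewrite !expnS expn0; nia.
Qed.

Lemma exists_log2 (k : nat) : (0 < k)%N ->
  exists n, (k < 2 ^ n)%N /\ (2 ^ n <= 2 * k)%N.
Proof.
move=> k0; exists (trunc_log 2 k).+1.
have /andP [h1 h2] := @trunc_log_bounds 2 k isT k0.
by split=> //; rewrite expnS leq_mul2l h1 orbT.
Qed.

(** Here [n] plays the role of a logarithm: the bound on [2 ^ n] makes it O(log 2k). *)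
Lemma subgroup_bound (r : nat) A (k : nat) :
  (0 < r)%N -> (forall x : G, x *+ r = 0) ->
  A != fset0 -> (#|` A :+: A| <= k * #|` A|)%N ->
  exists W, exists2 n : nat, (2 ^ n <= 256 * k ^ 2)%N &
    [/\ is_subgroup W, A `<=` W &
        (#|` W| <= 4 * r ^ (256 * (33 * k) + 2 * k * n) * #|` A|)%N].
Proof.
move=> r0 Gr A0 hA.
have A_gt0 : (0 < #|` A|)%N by rewrite cardfs_gt0.
have k0 : (0 < k)%N.
  rewrite lt0n; apply: contraTneq hA => ->; rewrite mul0n -ltnNge.
  exact: leq_trans A_gt0 (leq_card_addl A A A0).
have mono E F : E `<=` F -> (#|` E| <= #|` F|)%N by exact: fsubset_leq_card.
have [B1 [sB1 up1 gr1 AB1]] := popular_sumset r A k 3 r0 Gr A0 hA.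
have B1_gt0 : (0 < #|` B1|)%N by rewrite cardfs_gt0; apply/fset0Pn; exists 0; case: sB1.
(* As [c ^ 3 > 4 * k], three doublings of [B1] cannot all expand by [c]. *)
have [|c [c0 kc ck]] := exists_cube_root (4 * k); first by rewrite muln_gt0.
have [|i i3 hi] := growth_pigeonhole (fun i => #|` iter i dbl B1|) c 3.
  by apply: leq_ltn_trans gr1 _; rewrite ltn_pmul2r.
set A2 := iter i dbl B1 in hi.
have sA2 : symmetric0 A2 by exact: symmetric0_dbl.
have A20 : A2 != fset0 by apply/fset0Pn; exists 0; case: sA2.
have A2_gt0 : (0 < #|` A2|)%N by rewrite cardfs_gt0.
have {hi} hA2 : (#|` A2 :+: A2| <= c * #|` A2|)%N by exact: ltnW.
have upA2 : (#|` A2| <= 2 * (r ^ (32 * k) * #|` A|))%N.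
  apply: leq_trans up1; apply: mono; apply: iter_dbl_mono; first by case: sB1.
  exact: ltnW.
(* As [2 ^ m > 4 * c], one of [m] successive fourfold steps grows by less than 2, which yields a
   subgroup. *)
have [|m [cm mc]] := exists_log2 (4 * c); first by rewrite muln_gt0.
have [B2 [sB2 up2 gr2 AB2]] := popular_sumset r A2 c (2 * m) r0 Gr A20 hA2.
have B2_gt0 : (0 < #|` B2|)%N by rewrite cardfs_gt0; apply/fset0Pn; exists 0; case: sB2.
have [|j jm hj] := growth_pigeonhole (fun i => #|` iter (2 * i) dbl B2|) 2 m.
  by apply: leq_ltn_trans gr2 _; rewrite ltn_pmul2r.
set X := iter (2 * j) dbl B2 in hj.
have gH : is_subgroup (dbl X).
  apply: subgroup_of_small_fourfold; first exact: symmetric0_dbl.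
  by move: hj; rewrite mulnS addnC addn2 !iterS.
set H := dbl X in gH.
have B20 : 0 \in B2 by case: sB2.
have HE : H = iter (2 * j).+1 dbl B2 by rewrite iterS.
have B2H : B2 `<=` H by rewrite HE; apply: fsub_iter_dbl.
have cH : (#|` H| <= 4 * r ^ (256 * (33 * k)) * #|` A|)%N.
  apply: leq_trans (_ : _ <= 2 * (r ^ (256 * (32 * k)) * #|` A2|))%N _.
    apply: leq_trans (_ : _ <= #|` iter (2 * m) dbl B2|)%N _.
      by rewrite HE; apply/mono/iter_dbl_mono => //; lia.
    apply: leq_trans up2 _; rewrite leq_mul2l leq_mul2r; apply/orP; right.
    apply/orP; right; apply: leq_pexp2l => //.
    (* The generator count [4 * 2 ^ (2m) * c] is O(c^3), hence O(k): this is why [c] was made a cube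
       root. *)
    rewrite (mulnC 2 m) expnM; apply: leq_trans (_ : _ <= 4 * (8 * c) ^ 2 * c)%N _.
      by rewrite leq_mul2r leq_mul2l leq_exp2r //; apply/orP; right; lia.
    have -> : (4 * (8 * c) ^ 2 * c = 256 * c ^ 3)%N by ring.
    by rewrite leq_mul2l; move: ck; rewrite mulnA.
  apply: leq_trans (leq_mul (leqnn 2) (leq_mul (leqnn _) upA2)) _.
  apply: leq_trans (_ : _ <= 4 * r ^ (256 * (32 * k) + 32 * k) * #|` A|)%N _.
    rewrite expnD; move: (r ^ _)%N (r ^ _)%N => x y; lia.
  by rewrite leq_mul2r leq_mul2l leq_pexp2l ?orbT //; lia.
have H_gt0 : (0 < #|` H|)%N by rewrite cardfs_gt0; apply/fset0Pn; exists 0; case: gH.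
pose A' := A `&` B1; pose F := A2 `&` B2.
have F_gt0 : (0 < #|` F|)%N by rewrite /F; lia.
have A'_gt0 : (0 < #|` A'|)%N by rewrite /A'; lia.
(* In the triangle inequality [F] lies in [H], so [F + H] costs only [|H|], while [F + A'] lies in
   [A2 + A2]. *)
have cA'H : (#|` A' :+: H| <= 2 * c * #|` H|)%N.
  rewrite -(leq_pmul2l F_gt0); apply: leq_trans (ruzsa_triangle F A' H gH) _.
  have h1 : (#|` F :+: A'| <= c * #|` A2|)%N.
    apply: leq_trans hA2; apply/mono/addfS; first exact: fsubsetIl.
    apply: fsubset_trans (fsubsetIr _ _) _; apply: fsub_iter_dbl.
    by case: sB1.
  have h2 : (#|` F :+: H| <= #|` H|)%N.
    apply/mono/fsubsetP => _ /addfP [x xF [y yH ->]]; apply: subgroupD => //.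
    by move: xF; rewrite inE => /andP [_]; apply/fsubsetP.
  apply: leq_trans (leq_mul h1 h2) _; rewrite !mulnA leq_mul2r; apply/orP; right.
  by apply: leq_trans (leq_mul (leqnn c) AB2) _; rewrite mulnC [(2 * _)%N]mulnC.
(* A second triangle inequality passes from [A'] to all of [A]. *)
have cAH : (#|` A :+: H| <= 4 * k * c * #|` H|)%N.
  rewrite -(leq_pmul2l A'_gt0); apply: leq_trans (ruzsa_triangle A' A H gH) _.
  have h1 : (#|` A' :+: A| <= k * #|` A|)%N.
    apply: leq_trans hA; apply/mono/addfS; first exact: fsubsetIl.
    exact: fsubset_refl.
  apply: leq_trans (leq_mul h1 cA'H) _; rewrite !mulnA leq_mul2r; apply/orP; right.
  apply: leq_trans (leq_mul (leq_mul (leq_mul (leqnn k) AB1) (leqnn 2)) (leqnn c)) _.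
  by rewrite -/A'; lia.
have [Y [YA Y0 hY]] := petridis A k A0 hA.
(* The crude bound [c <= c ^ 3 <= 32 * k] gives [4 * k * c <= 128 * k ^ 2]. *)
have [|n [kn nk]] := exists_log2 (128 * k ^ 2); first by rewrite muln_gt0 expn_gt0 k0.
have [||T cT hT] := chang_covering A Y k k0 hY Y0 n H.
- by rewrite -cardfs_gt0.
- apply: leq_ltn_trans (_ : _ <= 4 * k * c * #|` H|)%N _.
    by apply: leq_trans cAH; apply/mono/addfS; rewrite ?fsubset_refl.
  rewrite ltn_pmul2r //; apply: leq_ltn_trans kn.
  have cc : (c <= c ^ 3)%N by rewrite -{1}(expn1 c) leq_pexp2l.
  by move: (leq_trans cc ck); nia.
have [V [gV TV cV]] := subgroup_closure r T r0 Gr.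
have V0 := subgroup0 gV; have H0 := subgroup0 gH.
exists (H :+: V); exists n; first by apply: leq_trans nk _; lia.
split; first exact: addf_subgroup.
  apply: hT; [exact: addf_subgroup|exact: fsub_addl|].
  by apply: fsubset_trans TV _; rewrite addfC fsub_addl.
apply: leq_trans (leq_card_addf _ _) _.
apply: leq_trans (leq_mul cH (leq_trans cV (leq_pexp2l r0 cT))) _.
by rewrite expnD; nia.
Qed.

(** * The generated subgroup and the real exponent *)

Lemma subgroup_gen_sub A W : is_subgroup W -> A `<=` W ->
  finite_set (subgroup_gen A) /\ fset_set (subgroup_gen A) `<=` W.
Proof.
move=> gW AW; have sub : (subgroup_gen A `<=` [set` W])%classic.
  apply: smallest_sub => [|x]; last by move/fsubsetP: AW; apply.
  split=> [|x y]; rewrite !inE /=; first exact: subgroup0.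
  exact: subgroupB.
have fin : finite_set (subgroup_gen A) := sub_finite_set sub (finite_fset W).
by split=> //; rewrite -(set_fsetK W) -fset_set_sub.
Qed.

End Sumsets.

Lemma ln2_ge_half (R : realType) : 2^-1 <= ln (2 : R).
Proof.
have := @le_ln1Dx R (- 2^-1); have -> : 1 - 2^-1 = 2^-1 :> R by field.
by rewrite lnV ?posrE // => /(_ _); lra.
Qed.

(** Bounding [r] by [e^r] makes the constant linear in [r]; since [ln (2 * K) >= 1/2], its square
    absorbs constants and first powers. *)
Lemma exp_bound (R : realType) (r k n : nat) (K : R) :
  1 <= K -> k%:R <= 2 * K -> (2 ^ n <= 256 * k ^ 2)%N ->
  (4 * r ^ (256 * (33 * k) + 2 * k * n))%:R
    <= expR ((16 + 256 * 300 * r%:R) * K * ln (2 * K) ^+ 2).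
Proof.
move=> K1 kK hn; set t := ln (2 * K); have l2 := ln2_ge_half R.
have tl2 : ln 2 <= t by rewrite ler_ln ?posrE //; lra.
have nt : n%:R <= 8 + 4 * t.
  have h : n%:R * ln 2 <= 8 * ln 2 + 2 * t.
    have : ((2 : R) ^+ n) <= 2 ^+ 8 * (2 * K) ^+ 2.
      rewrite -natrX; apply: (@le_trans _ _ (256 * k ^ 2)%:R); first by rewrite ler_nat.
      rewrite natrM natrX ler_pM ?exprn_ge0 //; first by rewrite -natrX ler_nat.
      by rewrite ler_pXn2r ?nnegrE //; lra.
    rewrite -ler_ln ?posrE ?mulr_gt0 ?exprn_gt0 //; try lra.
    rewrite lnM ?posrE ?exprn_gt0 //; try lra.
    by rewrite !lnXn //; try lra; rewrite -/t -!(mulr_natl (ln _)).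
  (* For [n > 8], multiplying [ln 2 >= 1/2] by [n - 8] removes [ln 2] from [h]. *)
  case: (lerP n%:R (8 : R)) => [|n8]; first by lra.
  have n80 : 0 <= n%:R - 8 :> R by lra.
  by have := ler_wpM2l n80 l2; lra.
have E : (256 * (33 * k) + 2 * k * n)%:R <= 256 * 300 * (K * t ^+ 2).
  rewrite !(natrD, natrM).
  have k0 : (0 : R) <= k%:R by [].
  have n0 : (0 : R) <= n%:R by [].
  apply: (@le_trans _ _ (2 * K * (256 * 33 + 2 * (8 + 4 * t)))).
    have -> : 256 * (33 * k%:R) + 2 * k%:R * n%:R = k%:R * (256 * 33 + 2 * n%:R) :> R by ring.
    by apply: ler_pM => //; lra.
  have t_ge : 2^-1 <= t by lra.
  have t2 : t <= 2 * t ^+ 2 by nra.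
  have -> : 256 * 300 * (K * t ^+ 2) = 2 * K * (128 * 300 * t ^+ 2) by ring.
  by apply: ler_wpM2l; lra.
rewrite natrM natrX.
have r_exp : r%:R <= expR (r%:R : R).
  by apply: le_trans (expR_ge1Dx _); rewrite lerDr.
have h4 : (4 : R) <= expR (16 * K * t ^+ 2).
  apply: le_trans (expR_ge1Dx _).
  have t2 : 4^-1 <= t ^+ 2 by nra.
  by have := ler_pM _ _ K1 t2; rewrite !mul1r; lra.
have -> : (16 + 256 * 300 * r%:R) * K * t ^+ 2
    = 16 * K * t ^+ 2 + 256 * 300 * (K * t ^+ 2) * r%:R by ring.
rewrite expRD ler_pM ?exprn_ge0 //.
apply: (@le_trans _ _ (expR r%:R ^+ (256 * (33 * k) + 2 * k * n))).
  by rewrite lerXn2r ?nnegrE ?expR_ge0.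
by rewrite -expRM_natl ler_expR ler_wpM2r.
Qed.

Theorem theorem1p2 (R : realType) (r : nat) (hr : (1 <= r)%N) :
  exists2 C : R, 0 < C &
    forall (G : zmodType) (A : {fset G}) (K : R),
      has_exponent G r ->
      A != fset0 ->
      (#|` sumset A|)%:R <= K * (#|` A|)%:R ->
      finite_set (subgroup_gen A) /\
      (#|` fset_set (subgroup_gen A)|)%:R
        <= expR (C * K * ln (2 * K) ^+ 2) * (#|` A|)%:R.
Proof.
exists (16 + 256 * 300 * r%:R) => [|G A K [_ Gr _] A0 hA].
  by have : (0 : R) <= r%:R by []; lra.
have A_gt0 : 0 < (#|` A|)%:R :> R by rewrite ltr0n cardfs_gt0.
have K1 : 1 <= K.
  rewrite -(ler_pM2r A_gt0) mul1r; apply: le_trans hA; rewrite ler_nat.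
  exact: (leq_card_addl A A A0).
(* An integer above [K]; [K >= 1] keeps it at most [2 * K]. *)
pose k := (Num.truncn K).+1.
have Kk : K < k%:R by exact: truncnS_gt.
have kK : k%:R <= 2 * K.
  have : (Num.truncn K)%:R <= K by rewrite truncn_le //; lra.
  by rewrite /k -natr1; lra.
have hk : (#|` addf A A| <= k * #|` A|)%N.
  rewrite -(ler_nat R) natrM; apply: le_trans hA _.
  by rewrite ler_pM2r // ltW.
have [W [n hn [gW AW cW]]] := subgroup_bound r A k hr Gr A0 hk.
have [fin sub] := subgroup_gen_sub A W gW AW.
split=> //; apply: (@le_trans _ _ (#|` W|)%:R).
  by rewrite ler_nat; apply: fsubset_leq_card.
apply: (@le_trans _ _ (4 * r ^ (256 * (33 * k) + 2 * k * n) * #|` A|)%:R).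
  by rewrite ler_nat.
by rewrite natrM ler_pM2r //; apply: exp_bound.
Qed.
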